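(* Let $G$ be a finite simple graph with a dominating set $S$, and let $S'\subseteq S$ be such that every vertex of $V(G)-S$ has a neighbor in $S'$. Then $\pi^{c}(G)\le |S|+|S'|$. In particular, $\pi^{c}(G)\le 2\gamma(G)$.
   Context: $\gamma(G)$ is the domination number of $G$. A configuration of cops on $G$ is a function $C:V(G)\to\mathbb{Z}_{\ge 0}$ of size $\sum_v C(v)$. A pebbling step from a vertex $u$ with at least two cops to an adjacent vertex $v$ removes two cops from $u$ and adds one cop to $v$. In the cops and robbers pebbling game, cops are placed according to $C$, then a robber chooses a starting vertex; thereafter, in each turn the cops make pebbling steps, after which the robber either moves to an adjacent vertex or stays put. The robber is captured when he occupies a vertex holding at least one cop. The cop pebbling number $\pi^{c}(G)$ is the minimum $m$ such that some configuration of size $m$ allows the cops to capture the robber regardless of how he starts and moves. *)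

(* Defs.v *)
From mathcomp Require Import all_boot.
From mathcomp Require Import boolp.
From Stdlib Require Relation_Operators.

Set Implicit Arguments.
Unset Strict Implicit.
Unset Printing Implicit Defensive.

(* A finite simple graph is a finite type [T] of vertices with a symmetric,
   irreflexive adjacency relation [e : rel T]. *)

Section Domination.
Variables (T : finType) (e : rel T).

Definition dominating (S : {set T}) : bool :=
  [forall v, (v \in S) || [exists u in S, e v u]].

Lemma dominating_setT : dominating [set: T].
Proof. by apply/forallP => v; rewrite inE. Qed.

Definition domination_number : nat :=
  #|[arg min_(S < [set: T] | dominating S) #|S| ]|.

End Domination.

Section CopPebbling.
Variables (T : finType) (e : rel T).

Definition config := {ffun T -> nat}.

Definition config_size (C : config) : nat := \sum_v C v.

Definition pebbling_step (C D : config) : Prop :=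
  exists u v : T,
    [/\ e u v, 2 <= C u
      & D = [ffun w => C w - (if w == u then 2 else 0)
                           + (if w == v then 1 else 0)]].

(* The cops' moves in one turn: any finite number of successive pebbling
   steps, possibly none. *)
Definition cop_turn : config -> config -> Prop :=
  Relation_Operators.clos_refl_trans config pebbling_step.

(* [r 0] is the robber's starting vertex, and [r t] his position after [t]
   rounds. *)
Definition robber_walk (r : nat -> T) : Prop :=
  forall t, r t.+1 = r t \/ e (r t) (r t.+1).

(* A cop strategy [s] maps the robber's positions observed so far, oldest
   first, to the resulting cop configuration.  Against the walk [r], the cops
   stand at [s (mkseq r t)] when the robber arrives at [r t] (so at [s [::]]
   when he chooses his starting vertex), and they then play to
   [s (mkseq r t.+1)], before he leaves [r t].  Capture can occur at either of
   these two moments; the cops may simply stop moving afterwards, so requiring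
   legal turns forever is harmless. *)
Definition cop_win (C : config) : Prop :=
  exists2 s : seq T -> config, s [::] = C &
    forall r, robber_walk r ->
      (forall t, cop_turn (s (mkseq r t)) (s (mkseq r t.+1))) /\
      (exists t, 0 < s (mkseq r t) (r t) \/ 0 < s (mkseq r t.+1) (r t)).

Definition cop_win_size (m : nat) : Prop :=
  exists2 C : config, config_size C = m & cop_win C.

Lemma cop_win_size_ex : exists m, `[< cop_win_size m >].
Proof.
pose C : config := [ffun=> 1].
exists (config_size C); apply/asboolP; exists C => //.
exists (fun=> C) => // r _; split=> [t|].
  exact: Relation_Operators.rt_refl.
by exists 0; left; rewrite ffunE.
Qed.

Definition cop_pebbling_number : nat := ex_minn cop_win_size_ex.

End CopPebbling.

(* Main.v *)
Require Import Defs.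
From mathcomp Require Import all_boot.
From mathcomp Require Import boolp.
From Stdlib Require Relation_Operators.

(** Put one cop on each vertex of [S] and a second one on each vertex of [S'].
    A robber who starts outside [S] is adjacent to a vertex of [S'], from which
    a single pebbling step lands on him before he moves. *)

Lemma cop_pebbling_number_le (T : finType) (e : rel T) (C : config T) :
  cop_win e C -> cop_pebbling_number e <= config_size C.
Proof.
move=> winC; rewrite /cop_pebbling_number; case: ex_minnP => m _; apply.
by apply/asboolP; exists C.
Qed.

(** The strategy reads only the head of the history, which is the robber's start [r 0]: the cops
    answer with a configuration covering it and then stand still. *)
Lemma cop_win_first_turn (T : finType) (e : rel T) (C : config T) :
  (forall x, exists2 D, cop_turn e C D & 0 < D x) -> cop_win e C.
Proof.
move=> catch.
(* A strategy is a function, so the winning replies must be chosen uniformly in [x]. *)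
have [D turnD D_gt0] : exists2 D : T -> config T,
    forall x, cop_turn e C (D x) & forall x, 0 < D x x.
  have /choice[D DP] : forall x, exists D, cop_turn e C D /\ 0 < D x.
    by move=> x; have [D ? ?] := catch x; exists D.
  by exists D => x; have [] := DP x.
exists (fun h => if h is x :: _ then D x else C) => // r _.
split=> [[|t]|]; [exact: turnD | exact: Relation_Operators.rt_refl |].
(* Capture comes in round 0, after the cops' reply and before the robber leaves [r 0]. *)
by exists 0; right; apply: D_gt0.
Qed.

Lemma cop_pebbling_number_dominating (T : finType) (e : rel T)
    (S S' : {set T}) (e_sym : symmetric e) :
  S' \subset S -> (forall v, v \notin S -> exists2 u, u \in S' & e v u) ->
  cop_pebbling_number e <= #|S| + #|S'|.
Proof.
move=> sS'S domS'; pose C : config T := [ffun v => (v \in S) + (v \in S')].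
have <- : config_size C = #|S| + #|S'|.
  (* Both cardinals become sums of indicators over all of [T], to be compared vertex by vertex. *)
  rewrite -!sum1_card big_mkcond [X in _ = _ + X]big_mkcond -big_split /=.
  by apply: eq_bigr => v _; rewrite ffunE; do 2!case: (_ \in _).
apply/cop_pebbling_number_le/cop_win_first_turn => x.
have [xS | xNS] := boolP (x \in S).
  by exists C; [exact: Relation_Operators.rt_refl | rewrite ffunE xS].
have [u uS' exu] := domS' x xNS.
exists [ffun w => C w - (if w == u then 2 else 0) + (if w == x then 1 else 0)].
  apply: Relation_Operators.rt_step; exists u, x; split=> //.
    by rewrite e_sym.
  (* As [S'] lies in [S], both indicators are 1 at [u]: exactly the two cops that the step costs. *)
  by rewrite ffunE uS' (subsetP sS'S).
by rewrite ffunE eqxx addn1.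
Qed.

Theorem theorem4 (T : finType) (e : rel T)
    (e_sym : symmetric e) (e_irr : irreflexive e) :
  (forall S S' : {set T},
      dominating e S ->
      S' \subset S ->
      (forall v, v \notin S -> exists2 u, u \in S' & e v u) ->
      cop_pebbling_number e <= #|S| + #|S'|)
  /\ cop_pebbling_number e <= 2 * domination_number e.
Proof.
split=> [S S' _|]; first exact: cop_pebbling_number_dominating.
rewrite /domination_number; case: arg_minnP => [|S domS _].
  exact: dominating_setT.
(* Take [S' = S] for a minimum dominating set [S]. *)
rewrite mul2n -addnn; apply: cop_pebbling_number_dominating => // v vNS.
have := forallP domS v; rewrite (negPf vNS) => /existsP[u /andP[uS evu]].
by exists u.
Qed.
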